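(* Let $\mathbb{V}=\{\mathbb{V}_\alpha\mid\alpha\in\Gamma_1\}\in\check{Z}^1(\mathfrak{U}_\Gamma,\mathcal{A}ut(\pi_* ))$ be the Voros cocycle and $\mathbb{\Delta}=\{\mathbb{\Delta}_\alpha^\pm\mid\alpha\in\Gamma_1\}\in\check{Z}^1(\mathfrak{U}_{\vec\Gamma},\mathcal{H}om(\mathrm{id},\sigma^* ))$ the abelian cocycle of sheet-transposition parallel transports. Then $$\mathbb{V}=\mathbb{1}+\pi_*\mathbb{\Delta},$$ where $\mathbb{1}$ is the identity cocycle.
   Context: Setting. $X$ is a compact smooth complex curve of genus $g_X$, $D\subset X$ a nonempty finite set with $|D|>2-2g_X$. Residue data is $a=(a_p)_{p\in D}$, $a_p\in\mathbb{C}$; write $\pm\lambda_p$ for the square roots of $a_p$. It is generic if $\mathrm{Re}(\lambda_p)\neq 0$ and $\lambda_p\notin\frac12\mathbb{Z}$ for all $p$; signs are chosen so that $\mathrm{Re}(\lambda_p)>0$. A quadratic differential on $(X,D)$ is a holomorphic section $\phi$ of $S^2\Omega^1_X(2D)$; its residue at $p$ is the coefficient $a_p$ in $\phi=(a_px^{-2}+\cdots)dx^2$. It is generic if all its zeroes are simple. For $\phi$ generic with generic residues $a$, the spectral curve $\Sigma$ is the curve of square roots of $\phi$ in the total space of $\Omega^1_X(D)$; $\pi:\Sigma\to X$ is a simply ramified double cover branched exactly at the set $B$ of zeroes of $\phi$, with ramification divisor $R$, involution $\sigma$, $C=\pi^{-1}(D)$, and canonical (tautological) one-form $\eta$. The preimages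 of $p\in D$ are labelled $p_\pm$ so that $\mathrm{Res}_{p_\pm}\eta=\pm\lambda_p$. Stokes graph. On $\Sigma\setminus(C\cup R)$ integrate the real line field $\ker(\mathrm{Im}\,\eta)$; its image under $\pi$ is the horizontal foliation of $X\setminus(D\cup B)$. A leaf is critical if one of its endpoints is in $B$ (resp. in $R$ for leaves on $\Sigma$), and a leaf on $X$ is a saddle trajectory if both endpoints are in $B$. $\phi$ is saddle-free if there are no saddle trajectories; $a$ is very generic if it is generic and some generic saddle-free $\phi$ has residues $a$. Fix very generic $a$ and such a $\phi$. The Stokes graph $\Gamma$ has vertices $D\cup B$ and edges $\Gamma_1$ (Stokes rays) the critical leaves, each joining a polar vertex in $D$ to a branch vertex in $B$; its faces are the Stokes regions. The spectral graph $\vec\Gamma$ on $\Sigma$ is its preimage, with vertices $C\cup R$; its faces are the spectral regions. Each Stokes region $I$ has two preimages, $I=\{i,i'\}$, $i'=\sigma(i)$, and each Stokes ray $\alpha$ with polar vertex $p$ has two preimages $\alpha_\pm$ with polar vertices $p_\pm$. $U_I,U_\alpha,U_i,U_\alpha^\pm$ are (germs of) small contractible open neighbourhoods of these faces and edges in $X^\circ=X\setminus(D\cup B)$ and $\Sigma^\circ=\Sigma\setminus(C\cup R)$; $\mathfrak{U}_\Gamma=\{U_I\}$ and $\mathfrak{U}_{\vec\Gamma}=\{U_i\}$ are the resulting open covers, whose double intersections have as connected components the $U_\alpha$ and the $U_\alpha^\pm$ respectively, with empty triple intersections. If $U_\alpha\subset U_I\cap U_J$, the pair $(U_I,U_J)$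 is ordered so that going from $U_I$ to $U_J$ crosses $\alpha$ anti-clockwise around its branch vertex. Categories. $\mathrm{Conn}_\Sigma^1$ is the category of $(\mathcal{L},\partial,\mu)$ with $\mathcal{L}$ a line bundle on $\Sigma$, $\partial$ a logarithmic connection with poles along $C\cup R$ and residues $\pm\lambda_p$ at $p_\pm$, $-1/2$ along $R$, and $\mu:\mathcal{L}\otimes\sigma^*\mathcal{L}\to\mathcal{O}_\Sigma(R)$ a flat isomorphism (for the connection on $\mathcal{O}_\Sigma(R)$ making $\mathcal{O}_\Sigma\to\mathcal{O}_\Sigma(R)$ flat) with $\sigma^*\mu=-\mu$; morphisms are flat maps $\varphi$ with $\mu'\circ(\varphi\otimes\sigma^*\varphi)=\mu$. Write $\mathbb{L}=\ker\partial$ and $\pi_*\mathbb{L}=\ker(\pi_*\partial)$ for the local systems on $\Sigma^\circ$ and $X^\circ$. Sheet transposition. For a Stokes ray $\alpha$ with branch vertex $b$ and a point $p\in U_\alpha$ with preimages $p_\pm\in U_\alpha^\pm$, let $\delta_p^+$ be the path on $\Sigma^\circ$ (up to homotopy) which is the unique lift starting at $p_+$ of a small clockwise loop based at $p$ around $b$; it ends at $p_-$. For $(\mathcal{L},\partial,\mu)\in\mathrm{Conn}_\Sigma^1$ set $\Delta_\alpha^+|_{p_+}=\mathrm{Par}(\partial,\delta_p^+):\mathcal{L}|_{p_+}\to\mathcal{L}|_{p_-}$ (parallel transport), giving $\Delta_\alpha^+\in\mathrm{Hom}(\mathbb{L}|_{U_\alpha^+},\sigma^*\mathbb{L}|_{U_\alpha^+})$,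 and set $\Delta_\alpha^-=0\in\mathrm{Hom}(\mathbb{L}|_{U_\alpha^-},\sigma^*\mathbb{L}|_{U_\alpha^-})$. As $(\mathcal{L},\partial,\mu)$ varies these form natural transformations $\mathbb{\Delta}_\alpha^\pm:\mathrm{id}\Rightarrow\sigma^*$ over $U_\alpha^\pm$, where $\sigma^*:\mathrm{Conn}^1_\Sigma\to\mathrm{Conn}^1_\Sigma$ is pullback; $\mathcal{H}om(\mathrm{id},\sigma^* )$ denotes the local system on $\Sigma^\circ$ of (flat) natural transformations $\mathrm{id}\Rightarrow\sigma^*$, and $\mathbb{\Delta}=\{\mathbb{\Delta}^\pm_\alpha\}$. Voros cocycle. For $(\mathcal{L},\partial,\mu)\in\mathrm{Conn}_\Sigma^1$ and a Stokes ray $\alpha$, let $V_\alpha$ be the automorphism of $\pi_*\mathbb{L}|_{U_\alpha}$ whose value at $p\in U_\alpha$, with respect to $\pi_*\mathcal{L}|_p=\mathcal{L}|_{p_-}\oplus\mathcal{L}|_{p_+}$, is $\begin{pmatrix}1&\Delta_\alpha^+|_{p_+}\\0&1\end{pmatrix}$. As $(\mathcal{L},\partial,\mu)$ varies these form a natural automorphism $\mathbb{V}_\alpha$ of the pushforward functor $\pi_*$ over $U_\alpha$; $\mathcal{A}ut(\pi_* )$ denotes the local system of nonabelian groups on $X^\circ$ of natural automorphisms of $\pi_*$, and $\mathbb{V}=\{\mathbb{V}_\alpha\}$. Pushforward of cocycles. For $p\in U_\alpha$, the inclusion $\mathrm{Hom}(\mathbb{L}_{p_\pm},\sigma^*\mathbb{L}_{p_\pm})=\mathrm{Hom}(\mathbb{L}_{p_\pm},\mathbb{L}_{p_\mp})\hookrightarrow\mathrm{End}(\mathbb{L}_{p_-}\oplus\mathbb{L}_{p_+})=\mathrm{End}(\pi_*\mathbb{L}_p)$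 is denoted $c\mapsto\pi_*c$. A cocycle $c=\{c_\alpha^\pm\}$ on $\mathfrak{U}_{\vec\Gamma}$ valued in $\mathcal{H}om(\mathrm{id},\sigma^* )$ is sent to $\mathbb{1}+\pi_*c$ on $\mathfrak{U}_\Gamma$, with component over $U_\alpha$ equal to $\mathrm{id}+\pi_*c_\alpha^++\pi_*c_\alpha^-$. *)

(* Defs.v *)
From mathcomp Require Import all_boot all_order all_algebra.
From mathcomp Require Import complex.
From mathcomp Require Import all_classical all_reals all_analysis.
Set Implicit Arguments.
Unset Strict Implicit.
Unset Printing Implicit Defensive.
Import Order.TTheory GRing.Theory Num.Theory numFieldNormedType.Exports.
Local Open Scope classical_set_scope.
Local Open Scope ring_scope.

(* The complex field, typed so that the norm topology and the complex
   derivative of the library are found by inference. *)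
Definition Cplx (R : realType) : numClosedFieldType := R[i].

Record chart (R : realType) (T : topologicalType) := Chart {
  cdom : set T;
  coord :> T -> Cplx R;
  cinv : Cplx R -> T;
  cdom_open : open cdom;
  cimg_open : open (coord @` cdom);
  coordK : forall x, cdom x -> cinv (coord x) = x;
  coord_cont : {within cdom, continuous coord};
  cinv_cont : {within coord @` cdom, continuous cinv} }.

Definition dcoord (R : realType) (T : topologicalType) (c : chart R T)
    (f : T -> Cplx R) (x : T) : Cplx R := 'D_1 (f \o cinv c) (c x).

Record riemann_surface (R : realType) := RiemannSurface {
  rs_top :> topologicalType;
  atlas : set (chart R rs_top);
  rs_hausdorff : hausdorff_space rs_top;
  atlas_cover : forall x, exists2 c, atlas c & cdom c x;
  atlas_compat : forall c c', atlas c -> atlas c' ->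
    forall x, cdom c x -> cdom c' x -> derivable (c' \o cinv c) (c x) 1 }.

Section Surfaces.
Variables (R : realType) (X : riemann_surface R).
Local Notation C := (Cplx R).

Definition chart_at (x : X) (c : chart R X) : Prop := atlas c /\ cdom c x.

Definition holo_at (f : X -> C) (x : X) : Prop :=
  forall c, chart_at x c -> \forall z \near c x, derivable (f \o cinv c) z 1.

(* The coefficient of a section w of (Omega^1(P))^k near x0, relative to the
   frame (dz / (z - z0))^k if x0 is in P and dz^k otherwise.  Away from P,
   w c is the coefficient relative to dz^k in the chart c; at a point of P it is
   the value of the section relative to (dz / (z - z0))^k, that is, the residue,
   which does not depend on the chart. *)
Definition logtriv (k : nat) (P : set X) (w : chart R X -> X -> C)
    (c : chart R X) (x0 x : X) : C :=
  if x == x0 then w c x0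
  else (if x0 \in P then c x - c x0 else 1) ^+ k * w c x.

Definition logform (U : set X) (k : nat) (P : set X)
    (w : chart R X -> X -> C) : Prop :=
  (forall x c, U x -> chart_at x c -> holo_at (logtriv k P w c x) x) /\
  (forall x c c', U x -> ~ P x -> chart_at x c -> chart_at x c' ->
     w c x = w c' x * dcoord c c' x ^+ k).

Definition genus (g : nat) : Prop :=
  exists b : 'I_g -> chart R X -> X -> C,
    (forall i, logform setT 1 set0 (b i)) /\
    (forall w, logform setT 1 set0 w ->
       exists! k : 'rV[C]_g, forall x c, chart_at x c ->
         w c x = \sum_(i < g) k ord0 i * b i c x).

Variable D : set X.

Record quad_diff := QuadDiff {
  qd_coef :> chart R X -> X -> C;
  qd_logform : logform setT 2 D qd_coef }.

Definition qd_residue (phi : quad_diff) (a : X -> C) : Prop :=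
  forall p c, D p -> chart_at p c -> phi c p = a p.

Definition qd_zero (phi : quad_diff) : set X :=
  [set x | forall c, chart_at x c -> phi c x = 0].

Definition qd_generic (phi : quad_diff) : Prop :=
  forall x c, qd_zero phi x -> chart_at x c ->
    dcoord c (logtriv 2 D phi c x) x != 0.

Definition generic_residues (a : X -> C) : Prop :=
  forall p (l : C), D p -> l ^+ 2 = a p ->
    complex.Re l != 0 /\ forall m : int, l != m%:~R / 2%:R.

End Surfaces.

Section SpectralCurveDef.
Variables (R : realType) (X : riemann_surface R) (D : set X).
Local Notation C := (Cplx R).

(* The fibre coordinate, near s0, on the total space of Omega^1(D), for a map
   s |-> (pi s, lam s) to it; same convention as in logtriv. *)
Definition tottriv (T : topologicalType) (pi : T -> X)
    (lam : chart R X -> T -> C) (c : chart R X) (s0 s : T) : C :=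
  if pi s == pi s0 then lam c s
  else (if pi s0 \in D then c (pi s) - c (pi s0) else 1) * lam c s.

(* A compact Riemann surface embedded holomorphically by s |-> (pi s, lam s) in
   the total space of Omega^1(D), with image the curve w^2 = phi.  Being
   compact, it carries the topology of its image. *)
Record spectral_curve (phi : quad_diff D) := SpectralCurve {
  sc_surf :> riemann_surface R;
  sc_pi : sc_surf -> X;
  sc_lam : chart R X -> sc_surf -> C;
  sc_compact : compact [set: sc_surf];
  sc_lam_fibre : forall s c c', chart_at (sc_pi s) c -> chart_at (sc_pi s) c' ->
    sc_lam c s = sc_lam c' s * (if sc_pi s \in D then 1 else dcoord c c' (sc_pi s));
  sc_image : forall x c (w : C), chart_at x c ->
    (w ^+ 2 = phi c x <-> exists2 s, sc_pi s = x & sc_lam c s = w);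
  sc_inj : forall s t c, chart_at (sc_pi s) c ->
    sc_pi s = sc_pi t -> sc_lam c s = sc_lam c t -> s = t;
  sc_pi_cont : continuous sc_pi;
  sc_pi_holo : forall s c, chart_at (sc_pi s) c -> holo_at (c \o sc_pi) s;
  sc_lam_holo : forall s c, chart_at (sc_pi s) c ->
    holo_at (tottriv sc_pi sc_lam c s) s;
  sc_immersion : forall s c d, chart_at (sc_pi s) c -> chart_at s d ->
    dcoord d (c \o sc_pi) s != 0 \/ dcoord d (tottriv sc_pi sc_lam c s) s != 0;
  sc_sigma : sc_surf -> sc_surf;
  sc_pi_sigma : forall s, sc_pi (sc_sigma s) = sc_pi s;
  sc_lam_sigma : forall s c, chart_at (sc_pi s) c ->
    sc_lam c (sc_sigma s) = - sc_lam c s;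
  sc_eta : chart R sc_surf -> sc_surf -> C;
  sc_eta_logform : logform setT 1 (sc_pi @^-1` D) sc_eta;
  sc_eta_taut : forall s c d, ~ D (sc_pi s) -> chart_at (sc_pi s) c ->
    chart_at s d -> sc_eta d s = sc_lam c s * dcoord d (c \o sc_pi) s }.

End SpectralCurveDef.

Section Stokes.
Variables (R : realType) (X : riemann_surface R) (D : set X).
Variables (phi : quad_diff D) (S : spectral_curve phi).
Local Notation C := (Cplx R).
Local Notation pi := (@sc_pi _ _ _ _ S).
Local Notation sigma := (@sc_sigma _ _ _ _ S).
Local Notation eta := (@sc_eta _ _ _ _ S).
Local Notation B := (qd_zero phi).

Lemma sigmaK (s : S) : sigma (sigma s) = s.
Proof.
have [c ac xc] := atlas_cover (pi s).
have h1 : chart_at (pi (sigma s)) c by split => //; rewrite sc_pi_sigma.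
have h2 : chart_at (pi (sigma (sigma s))) c by split => //; rewrite !sc_pi_sigma.
apply: (sc_inj h2); first by rewrite !sc_pi_sigma.
by rewrite !sc_lam_sigma ?opprK.
Qed.

Definition polar_pts : set S := pi @^-1` D.
Definition ram_pts : set S := pi @^-1` B.
Definition punctures : set S := polar_pts `|` ram_pts.
Definition Xo : set X := ~` (D `|` B).
Definition So : set S := ~` punctures.

(* p_+ for true, p_- for false *)
Definition sgn_of (e : bool) : C := if e then 1 else -1.
Definition polar_pt (lambda : X -> C) (e : bool) : set S :=
  [set q | polar_pts q /\
           forall d, chart_at q d -> eta d q = sgn_of e * lambda (pi q)].

Definition in_itv (lo hi : \bar R) (t : R) : Prop :=
  (lo < t%:E)%E /\ (t%:E < hi)%E.

Definition velocity (d : chart R S) (gam : R -> S) (t : R) : C :=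
  ('D_1 (fun u => complex.Re (d (gam u) : R[i])) t
   +i* 'D_1 (fun u => complex.Im (d (gam u) : R[i])) t)%C.

(* Integral curves of ker (Im eta), parametrised by the integral of Re eta. *)
Definition trajectory (lo hi : \bar R) (gam : R -> S) : Prop :=
  (exists t, in_itv lo hi t) /\
  forall t, in_itv lo hi t ->
    [/\ So (gam t), gam u @[u --> t] --> gam t &
      forall d, chart_at (gam t) d ->
        [/\ derivable (fun u => complex.Re (d (gam u) : R[i])) t 1,
            derivable (fun u => complex.Im (d (gam u) : R[i])) t 1 &
            eta d (gam t) * velocity d gam t = 1]].

Definition maximal_trajectory (lo hi : \bar R) (gam : R -> S) : Prop :=
  trajectory lo hi gam /\
  forall lo' hi' gam', trajectory lo' hi' gam' -> (lo' <= lo)%E ->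
    (hi <= hi')%E -> (forall t, in_itv lo hi t -> gam' t = gam t) ->
    lo' = lo /\ hi' = hi.

(* up = true: the tail towards hi; up = false: the tail towards lo *)
Definition tail (up : bool) (lo hi : \bar R) (t0 t : R) : Prop :=
  in_itv lo hi t /\ (if up then t0 <= t else t <= t0).

Definition endpoint (T : topologicalType) (up : bool) (lo hi : \bar R)
    (f : R -> T) (q : T) : Prop :=
  forall N, nbhs q N -> exists t0, in_itv lo hi t0 /\
    forall t, tail up lo hi t0 t -> N (f t).

Definition leaf_image (T : Type) (lo hi : \bar R) (f : R -> T) : set T :=
  [set f t | t in [set t | in_itv lo hi t]].

Definition saddle_free : Prop :=
  ~ exists lo hi gam b b', [/\ maximal_trajectory lo hi gam, B b, B b',
      endpoint true lo hi (pi \o gam) b & endpoint false lo hi (pi \o gam) b'].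

Definition stokes_ray (al : set X) : Prop :=
  exists lo hi gam up b, [/\ maximal_trajectory lo hi gam,
    al = leaf_image lo hi (pi \o gam), B b & endpoint up lo hi (pi \o gam) b].

Definition spectral_ray (l : set S) : Prop :=
  exists lo hi gam up r, [/\ maximal_trajectory lo hi gam,
    l = leaf_image lo hi gam, ram_pts r & endpoint up lo hi gam r].

(* alpha_+ (e = true) and alpha_- (e = false) *)
Definition ray_lift (lambda : X -> C) (e : bool) (al : set X) : set S :=
  [set s | exists lo hi gam up q,
    [/\ maximal_trajectory lo hi gam /\ leaf_image lo hi gam s,
        spectral_ray (leaf_image lo hi gam),
        al = leaf_image lo hi (pi \o gam),
        polar_pt lambda e q & endpoint up lo hi gam q]].

End Stokes.

Arguments polar_pts {R X D phi} S.
Arguments ram_pts {R X D phi} S.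
Arguments punctures {R X D phi} S.
Arguments So {R X D phi} S.
Arguments polar_pt {R X D phi} S lambda e.
Arguments saddle_free {R X D phi} S.
Arguments stokes_ray {R X D phi} S al.
Arguments spectral_ray {R X D phi} S l.
Arguments ray_lift {R X D phi} S lambda e al.

Definition very_generic (R : realType) (X : riemann_surface R) (D : set X)
    (a : X -> Cplx R) : Prop :=
  generic_residues D a /\
  exists (phi : quad_diff D) (S : spectral_curve phi),
    [/\ qd_generic phi, qd_residue phi a & saddle_free S].

Section Covers.
Variable R : realType.

Definition contractible (T : topologicalType) (A : set T) : Prop :=
  exists2 x0, A x0 & exists H : R * T -> T,
    [/\ {within `[0%R, 1%R]%classic `*` A, continuous H},
        (forall t x, 0 <= t <= 1 -> A x -> A (H (t, x))),
        (forall x, A x -> H (0, x) = x) & (forall x, A x -> H (1, x) = x0)].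

Definition graph_face (T : topologicalType) (T0 : set T) (edge : set (set T))
    (F : set T) : Prop :=
  let V := T0 `\` \bigcup_(e in edge) e in
  exists2 x, V x & F = connected_component V x.

(* nF and nE choose the open neighbourhoods of the faces and of the edges of a
   graph in the punctured surface T0.  A face that lies on both sides of an edge
   is allowed; its neighbourhood, as a subset of T0, is then not contractible. *)
Record graph_cover (T : topologicalType) (T0 : set T) (edge : set (set T))
    (nF nE : set T -> set T) : Prop := GraphCover {
  gc_face : forall F, graph_face T0 edge F ->
    [/\ open (nF F), connected (nF F), nF F `<=` T0 & closure F `&` T0 `<=` nF F];
  gc_edge : forall e, edge e ->
    [/\ open (nE e), contractible (nE e), e `<=` nE e & nE e `<=` T0];
  gc_edge_disj : forall e e', edge e -> edge e' -> e <> e' ->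
    nE e `&` nE e' = set0;
  gc_double : forall F G, graph_face T0 edge F -> graph_face T0 edge G -> F <> G ->
    nF F `&` nF G =
    \bigcup_(e in [set e | edge e /\ e `<=` closure F `&` closure G]) nE e;
  gc_triple : forall F G H, graph_face T0 edge F -> graph_face T0 edge G ->
    graph_face T0 edge H -> F <> G -> G <> H -> F <> H ->
    nF F `&` nF G `&` nF H = set0 }.

Variables (X : riemann_surface R) (D : set X).
Variables (phi : quad_diff D) (S : spectral_curve phi) (lambda : X -> Cplx R).
Local Notation pi := (@sc_pi _ _ _ _ S).

(* U_I = st_face I, U_alpha = st_ray alpha, U_i = sp_face i, and
   U_alpha^e = sp_ray (ray_lift S lambda e alpha). *)
Record stokes_cover := StokesCover {
  st_face : set X -> set X;
  st_ray : set X -> set X;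
  sp_face : set S -> set S;
  sp_ray : set S -> set S;
  st_cover : graph_cover (Xo phi) (stokes_ray S) st_face st_ray;
  sp_cover : graph_cover (So S) (spectral_ray S) sp_face sp_ray;
  sp_face_proj : forall i, graph_face (So S) (spectral_ray S) i ->
    pi @` sp_face i = st_face (pi @` i);
  sp_ray_preimage : forall al, stokes_ray S al ->
    pi @^-1` st_ray al =
    sp_ray (ray_lift S lambda true al) `|` sp_ray (ray_lift S lambda false al);
  sp_ray_disj : forall al, stokes_ray S al ->
    sp_ray (ray_lift S lambda true al) `&` sp_ray (ray_lift S lambda false al)
    = set0;
  sp_ray_inj : forall al e, stokes_ray S al ->
    {in sp_ray (ray_lift S lambda e al) &, injective pi} }.

End Covers.

(* A holomorphic line bundle as a family of lines with local holomorphic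
   frames. *)
Record line_bundle (R : realType) (S : riemann_surface R) := LineBundle {
  fib :> S -> lmodType (Cplx R);
  frame : set S -> (forall s, fib s) -> Prop;
  frame_open : forall U e, frame U e -> open U;
  frame_cover : forall s, exists U e, frame U e /\ U s;
  frame_basis : forall U e s, frame U e -> U s ->
    forall v, exists! k : Cplx R, v = k *: e s;
  frame_holo : forall U e U' e' s, frame U e -> frame U' e' -> U s -> U' s ->
    exists2 g, holo_at g s & \forall t \near s, e' t = g t *: e t }.

Definition fib_cast (R : realType) (S : riemann_surface R) (L : line_bundle S)
    (s t : S) (E : s = t) (v : L s) : L t := ecast z (L z) E v.

Definition lin (K : pzRingType) (V W : lmodType K) (f : V -> W) : Prop :=
  forall (k : K) u v, f (k *: u + v) = k *: f u + f v.

Section Conn.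
Variables (R : realType) (X : riemann_surface R) (D : set X).
Variables (phi : quad_diff D) (S : spectral_curve phi) (lambda : X -> Cplx R).
Local Notation C := (Cplx R).
Local Notation pi := (@sc_pi _ _ _ _ S).
Local Notation sigma := (@sc_sigma _ _ _ _ S).
Local Notation ram := (ram_pts S).
Local Notation punct := (punctures S).

(* The connection is given by its forms: d e = conn_form U e * e.  In
   conn_polar and conn_ram, conn_form is evaluated at a pole, where it is the
   residue (see logtriv).
   The pairing mu is given off R, where the section 1 trivialises O(R); mu_pole
   says that it extends over R as an isomorphism onto O(R). *)
Record conn1 := Conn1 {
  c1_bundle :> line_bundle S;
  conn_form : set S -> (forall s, c1_bundle s) -> chart R S -> S -> C;
  conn_logform : forall U e, frame U e -> logform U 1 punct (conn_form U e);
  conn_change : forall U e U' e' s (g : S -> C) d,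
    frame U e -> frame U' e' -> U s -> U' s -> ~ punct s -> chart_at s d ->
    holo_at g s -> (\forall t \near s, e' t = g t *: e t) ->
    conn_form U' e' d s = conn_form U e d s + dcoord d g s / g s;
  conn_polar : forall U e s d b, frame U e -> U s -> chart_at s d ->
    polar_pt S lambda b s -> conn_form U e d s = sgn_of R b * lambda (pi s);
  conn_ram : forall U e s d, frame U e -> U s -> chart_at s d -> ram s ->
    conn_form U e d s = - 2%:R^-1;
  mu : forall s, c1_bundle s -> c1_bundle (sigma s) -> C;
  mu_linl : forall s (v : c1_bundle (sigma s)), ~ ram s ->
    lin (V := c1_bundle s) (W := C^o) (fun u => mu u v);
  mu_linr : forall s (u : c1_bundle s), ~ ram s ->
    lin (V := c1_bundle (sigma s)) (W := C^o) (mu u);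
  mu_holo : forall U e U' e' s, frame U e -> frame U' e' -> U s -> U' (sigma s) ->
    ~ ram s -> holo_at (fun t => mu (e t) (e' (sigma t))) s
               /\ mu (e s) (e' (sigma s)) != 0;
  mu_pole : forall U e U' e' s d, frame U e -> frame U' e' -> U s ->
    U' (sigma s) -> chart_at s d -> ram s ->
    exists2 k : C, k != 0 &
      holo_at (fun t => if t == s then k
                        else (d t - d s) * mu (e t) (e' (sigma t))) s;
  (* the section 1 of O(R) is flat *)
  mu_flat : forall U e U' e' s d d', frame U e -> frame U' e' -> U s ->
    U' (sigma s) -> ~ punct s -> chart_at s d -> chart_at (sigma s) d' ->
    dcoord d (fun t => mu (e t) (e' (sigma t))) s =
    (conn_form U e d s
     + conn_form U' e' d' (sigma s) * dcoord d (d' \o sigma) s)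
    * mu (e s) (e' (sigma s));
  mu_skew : forall s (u : c1_bundle s) (v : c1_bundle (sigma s)), ~ ram s ->
    mu v (fib_cast (esym (sigmaK s)) u) = - mu u v }.

Record conn1_mor (L L' : conn1) := Conn1Mor {
  mor :> forall s, L s -> L' s;
  mor_lin : forall s, lin (@mor s);
  mor_holo : forall U e U' e' s, frame U e -> frame U' e' -> U s -> U' s ->
    exists2 g, holo_at g s & \forall t \near s, mor (e t) = g t *: e' t;
  mor_flat : forall U e U' e' s (g : S -> C) d,
    frame U e -> frame U' e' -> U s -> U' s -> ~ punct s -> chart_at s d ->
    holo_at g s -> (\forall t \near s, mor (e t) = g t *: e' t) ->
    dcoord d g s + g s * conn_form U' e' d s = conn_form U e d s * g s;
  mor_mu : forall s (u : L s) (v : L (sigma s)), ~ ram s ->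
    mu (mor u) (mor v) = mu u v }.

Arguments mor {L L'} m s v : rename.

(* f is a section over N of the local system ker d *)
Definition flat_on (L : conn1) (N : set S) (f : forall s, L s) : Prop :=
  forall s U e d, N s -> frame U e -> U s -> chart_at s d ->
    exists h, [/\ holo_at h s, (\forall t \near s, f t = h t *: e t) &
                  dcoord d h s + h s * conn_form U e d s = 0].

(* A flat lift of the path del leads from v over s to w over t. *)
Definition transports (L : conn1) (del : R -> S) (s t : S) (v : L s) (w : L t) :
    Prop :=
  exists E : R -> {x : S & L x},
    [/\ (forall u, 0 <= u <= 1 -> projT1 (E u) = del u),
        E 0 = existT _ s v, E 1 = existT _ t w &
        forall u, 0 <= u <= 1 -> exists N f,
          [/\ open N, N (del u), N `<=` So S, flat_on N f &
              \forall u' \near u, 0 <= u' <= 1 ->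
                E u' = existT _ (del u') (f (del u'))]].

(* exp (- 2 i pi u): clockwise *)
Definition clockwise (u : R) : C :=
  (cos (2%:R * trigo.pi * u) +i* - sin (2%:R * trigo.pi * u))%C.

(* Run along beta for u <= 1/3, once clockwise around the point with coordinate
   c b for 1/3 <= u <= 2/3, and back along beta. *)
Definition lasso (beta : R -> X) (c : chart R X) (b : X) (u : R) : X :=
  if u <= 3%:R^-1 then beta (3%:R * u)
  else if u <= 2%:R / 3%:R then
    cinv c (c b + (c (beta 1) - c b) * clockwise (3%:R * u - 1))
  else beta (3%:R - 3%:R * u).

(* Lifts, starting at s, of the small clockwise loop based at pi s around the
   branch vertex b of al, where pi s lies in the neighbourhood Ua of al: the
   loop reaches a point of al by a path in Ua, turns around b along a circle, and
   comes back.  The disc bounded by the circle lies in a chart, has b as its only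
   vertex, and contains the part of al between the circle and b; this determines
   the loop up to homotopy in Xo. *)
Definition sheet_path (al Ua : set X) (s : S) (del : R -> S) : Prop :=
  exists lo hi gam up b t0 (beta : R -> X) c,
  let disc x := cdom c x /\ `|c x - c b| <= `|c (beta 1) - c b| in
  [/\ [/\ maximal_trajectory lo hi gam, al = leaf_image lo hi (pi \o gam),
          qd_zero phi b & endpoint up lo hi (pi \o gam) b],
      [/\ {within `[0%R, 1%R]%classic, continuous beta},
          (forall u, 0 <= u <= 1 -> Ua (beta u)),
          beta 0 = pi s, in_itv lo hi t0 & beta 1 = pi (gam t0)],
      [/\ chart_at b c,
          (forall z : C, `|z - c b| <= `|c (beta 1) - c b| ->
             (c @` cdom c) z),
          (forall x, disc x -> D x \/ qd_zero phi x -> x = b) &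
          (forall t, tail up lo hi t0 t -> disc (pi (gam t)))] &
      [/\ {within `[0%R, 1%R]%classic, continuous del},
          (forall u, 0 <= u <= 1 -> So S (del u)),
          del 0 = s &
          (forall u, 0 <= u <= 1 -> pi (del u) = lasso beta c b u)]].

(* Delta_alpha^+ at the point s of U_alpha^+: the transport along any
   representative of the homotopy class of paths. *)
Definition sheet_transport (al Ua : set X) (L : conn1) (s : S) (v : L s) :
    L (sigma s) :=
  xget 0 [set w | exists2 del, sheet_path al Ua s del & transports del v w].

(* Sections over U of Hom(id, sigma^* ).  The stalk at s of sigma^* L is the
   stalk of L at sigma s, so the value at s is a map L s -> L (sigma s), and
   s |-> f' (sigma s) is a flat section of sigma^* L when f' is one of L. *)
Record hom_section (U : set S) := HomSection {
  hs :> forall (L : conn1) (s : S), L s -> L (sigma s);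
  hs_lin : forall (L : conn1) s, U s -> lin (@hs L s);
  hs_flat : forall (L : conn1) N f, open N -> N `<=` U -> flat_on (L := L) N f ->
    exists2 f', flat_on (L := L) (sigma @` N) f' &
      forall s, N s -> f' (sigma s) = hs (f s);
  hs_nat : forall (L L' : conn1) (m : conn1_mor L L') s v, U s ->
    hs (m s v) = m (sigma s) (hs v) }.

Arguments hs {U} h L s v : rename.

(* The fibre of pi_* L at x: the direct sum of the L s over the preimages s. *)
Definition push_pt (x : X) := {s : S | pi s = x}.
Definition push_fib (L : conn1) (x : X) := forall s : push_pt x, L (sval s).

Definition sigma_pt (x : X) (s : push_pt x) : push_pt x :=
  exist _ (sigma (sval s)) (etrans (sc_pi_sigma (sval s)) (svalP s)).

Definition push_section (L : conn1) (f : forall x, push_fib L x) (s : S) : L s :=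
  f (pi s) (exist _ s erefl).

Definition push_mor (L L' : conn1) (m : conn1_mor L L') (x : X)
    (u : push_fib L x) : push_fib L' x := fun s => m (sval s) (u s).

(* Sections over U of Aut(pi_* ).  A section of pi_* L over N is flat when it is
   flat as a section of L over the preimage of N. *)
Record aut_section (U : set X) := AutSection {
  aut_map :> forall (L : conn1) (x : X), push_fib L x -> push_fib L x;
  aut_lin : forall (L : conn1) x, U x -> forall (k : C) (u v : push_fib L x) s,
    aut_map (fun t => k *: u t + v t) s = k *: aut_map u s + aut_map v s;
  aut_bij : forall (L : conn1) x, U x -> bijective (@aut_map L x);
  aut_flat : forall (L : conn1) N (f : forall x, push_fib L x),
    open N -> N `<=` U -> flat_on (pi @^-1` N) (push_section f) ->
    flat_on (pi @^-1` N) (push_section (fun x => aut_map (f x)));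
  aut_nat : forall (L L' : conn1) (m : conn1_mor L L') x (u : push_fib L x), U x ->
    aut_map (push_mor m u) = push_mor m (aut_map u) }.

Arguments aut_map {U} a L x u : rename.

(* pi_* of a map c defined on the sheet W, extended by 0 on the summands over
   the other preimages *)
Definition push_hom (W : set S) (L : conn1) (c : forall s, L s -> L (sigma s))
    (x : X) (u : push_fib L x) : push_fib L x :=
  fun s => if sval (sigma_pt s) \in W
           then fib_cast (sigmaK (sval s)) (c (sval (sigma_pt s)) (u (sigma_pt s)))
           else 0.

Variable U : stokes_cover S lambda.

Definition Gamma1 := {al : set X | stokes_ray S al}.
Definition U_ (al : Gamma1) : set X := st_ray U (sval al).
Definition Upm (al : Gamma1) (e : bool) : set S :=
  sp_ray U (ray_lift S lambda e (sval al)).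

(* The connected components of the double overlaps are the neighbourhoods of the
   edges, the component at an edge being taken for the ordered pair of faces met
   when crossing it anti-clockwise around its branch vertex; triple overlaps are
   empty.  Hence a 1-cocycle is a family of sections, one for each edge. *)
Definition Z1_hom := forall (al : Gamma1) (e : bool), hom_section (Upm al e).
Definition Z1_aut := forall al : Gamma1, aut_section (U_ al).

Definition is_sheet_cocycle (Delta : Z1_hom) : Prop :=
  forall al (L : conn1) s (v : L s),
    (Upm al true s -> Delta al true L s v = sheet_transport (sval al) (U_ al) v) /\
    (Upm al false s -> Delta al false L s v = 0).

(* s is the point p_+ over x, so that sigma_pt s is p_- *)
Definition is_voros_cocycle (V : Z1_aut) : Prop :=
  forall al (L : conn1) x (u : push_fib L x) (s : push_pt x),
    U_ al x -> Upm al true (sval s) ->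
    V al L x u s = u s /\
    V al L x u (sigma_pt s) =
      u (sigma_pt s) + sheet_transport (sval al) (U_ al) (u s).

Definition one_plus_push (c : Z1_hom) (al : Gamma1) (L : conn1) (x : X)
    (u : push_fib L x) : push_fib L x :=
  fun s => u s + push_hom (Upm al true) (c al true L) u s
               + push_hom (Upm al false) (c al false L) u s.

Definition cochain_eq
    (f g : Gamma1 -> forall (L : conn1) x, push_fib L x -> push_fib L x) : Prop :=
  forall al L x, U_ al x -> f al L x = g al L x.

End Conn.

(* Main.v *)
(* Over a point of [U_al] there are exactly two preimages, one on each sheet, and
   they are exchanged by [sigma]; on the plus sheet both sides are the identity,
   and on the minus sheet both add the transport of the component at the plus
   preimage. *)
Require Import Defs.
From mathcomp Require Import all_boot all_order all_algebra.
From mathcomp Require Import complex.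
From mathcomp Require Import all_classical all_reals all_analysis.
Import Order.TTheory GRing.Theory Num.Theory numFieldNormedType.Exports.
Local Open Scope classical_set_scope.
Local Open Scope ring_scope.

Lemma fib_cast_additive (R : realType) (S : riemann_surface R)
    (L : line_bundle S) (s t : S) (E : s = t) (v w : L s) :
  fib_cast E (v + w) = fib_cast E v + fib_cast E w.
Proof. by case: t / E. Qed.

Lemma fib_cast0 (R : realType) (S : riemann_surface R)
    (L : line_bundle S) (s t : S) (E : s = t) :
  fib_cast E (0 : L s) = 0.
Proof. by case: t / E. Qed.

Section Sheets.
Context {R : realType} {X : riemann_surface R} {D : set X}.
Context {lambda : X -> Cplx R} {phi : quad_diff D} {S : spectral_curve phi}.

(** The tautological coordinate changes sign under the involution, so it vanishes at a fixed point,
    and [phi] is its square. *)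
Lemma sigma_fixed_zero (s : S) : sc_sigma s = s -> qd_zero phi (sc_pi s).
Proof.
move=> fix_s c cs.
have lam0 : sc_lam c s = 0.
  have := sc_lam_sigma cs; rewrite fix_s => /eqP.
  by rewrite -addr_eq0 -mulr2n mulrn_eq0 /= => /eqP.
have [_ on_curve] := sc_image S 0 cs.
by rewrite -on_curve ?expr0n //; exists s.
Qed.

(** Applying [sigma_pt] twice returns the same preimage only up to a propositional equality, so
    values in the two fibres can be compared only through a cast. *)
Lemma sigma_pt_fib_cast (L : conn1 S lambda) (x : X) (f : push_fib L x)
    (s : push_pt S x) :
  fib_cast (sigmaK (sval s)) (f (sigma_pt (sigma_pt s))) = f s.
Proof.
have E : sigma_pt (sigma_pt s) = s.
  by case: s => s xs; apply: eq_exist; exact: sigmaK.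
(* With [t] a variable the equality can be eliminated; proof irrelevance then identifies the
   resulting cast with the one along [sigmaK]. *)
have cast_congr t (e : t = s) : fib_cast (congr1 sval e) (f t) = f s.
  by case: s / e {E}.
rewrite -[RHS](cast_congr _ E); congr fib_cast; exact: Prop_irrelevance.
Qed.

Variable U : stokes_cover S lambda.

Lemma ray_preimage_cases (al : Gamma1 S) (s : S) : U_ U al (sc_pi s) ->
  Upm U al true s \/ Upm U al false s.
Proof.
by move=> Us; have := sp_ray_preimage U (svalP al) => /seteqP[+ _]; exact.
Qed.

(** If both points lay on one sheet, injectivity of the projection there would make [s] fixed by the
    involution, hence lie over a zero of [phi]; but the neighbourhood of a ray avoids the zeroes. *)
Lemma sigma_swaps_sheets (al : Gamma1 S) (e : bool) (s : S) :
  U_ U al (sc_pi s) -> Upm U al e s -> Upm U al (~~ e) (sc_sigma s).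
Proof.
move=> Us es.
have not_e : ~ Upm U al e (sc_sigma s).
  move=> es'; have [_ _ _ /(_ _ Us) Xos] := gc_edge (st_cover U) (svalP al).
  apply: Xos; right; apply: sigma_fixed_zero.
  apply: (sp_ray_inj (svalP al)); last exact: sc_pi_sigma.
    exact/mem_set/es'.
  exact/mem_set/es.
have : U_ U al (sc_pi (sc_sigma s)) by rewrite sc_pi_sigma.
by case: e {es} not_e => not_e /ray_preimage_cases[].
Qed.

Lemma sheets_disjoint (al : Gamma1 S) (s : S) :
  Upm U al true s -> ~ Upm U al false s.
Proof.
move=> ts fs; have := sp_ray_disj U (svalP al).
by move/seteqP => [/(_ s) + _]; apply; split.
Qed.

End Sheets.

Theorem proposition3p10 (R : realType) (X : riemann_surface R) (g n : nat)
    (D : set X) (a lambda : X -> Cplx R) (phi : quad_diff D)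
    (S : spectral_curve phi) (U : stokes_cover S lambda)
    (V : Z1_aut U) (Delta : Z1_hom U) :
  compact [set: X] -> connected [set: X] -> genus X g ->
  D !=set0 -> (D #= `I_n)%card -> (2 < n + 2 * g)%N ->
  very_generic D a ->
  qd_generic phi -> qd_residue phi a -> saddle_free S ->
  (forall p, D p -> lambda p ^+ 2 = a p /\ 0 < complex.Re (lambda p)) ->
  is_voros_cocycle V ->
  is_sheet_cocycle Delta ->
  cochain_eq U (fun al => V al) (one_plus_push Delta).
Proof.
move=> _ _ _ _ _ _ _ _ _ _ _ voros sheet al L x Ux.
apply: funext => u; apply: functional_extensionality_dep => s.
have Us : U_ U al (sc_pi (sval s)) by rewrite (svalP s).
have push_minus0 : push_hom (Upm U al false) (Delta al false L) u s = 0.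
  rewrite /push_hom; case: ifPn => // /set_mem fs.
  by rewrite (sheet al L _ _).2 // fib_cast0.
rewrite /one_plus_push push_minus0 addr0 /push_hom.
have [ts|fs] := ray_preimage_cases U al _ Us.
  have ss := sigma_swaps_sheets U al true _ Us ts.
  (* The plus summand at [s] reads the component at the conjugate point, which is on the minus
     sheet, so it takes the default value 0. *)
  rewrite memNset; last by move=> /sheets_disjoint; exact.
  by rewrite addr0 (voros al L x u s Ux ts).1.
have ss : Upm U al true (sval (sigma_pt s)) :=
    sigma_swaps_sheets U al false _ Us fs.
rewrite mem_set // (sheet al L _ _).1 //.
(* The Voros formula is indexed by the plus preimage, so [s] is rewritten as the conjugate of
   [sigma_pt s]. *)
rewrite -[LHS]sigma_pt_fib_cast (voros al L x u (sigma_pt s) Ux ss).2.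
by rewrite fib_cast_additive sigma_pt_fib_cast.
Qed.
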